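(* Let $f:\mathbb{R}^d\to\mathbb{R}$ be convex and $L$-smooth ($L>0$), and suppose $f$ has at least one minimizer; let $\mathbf{x}^\star$ be any minimizer of $f$. Let $(\sigma_n)_{n\ge 1}$ be a sequence of positive real numbers, let $\mathbf{x}_0\in\mathbb{R}^d$, let $0<t\le \frac1L$, and define the GSmoothGD iterates $$\mathbf{x}_{k+1}=\mathbf{x}_k-t\,\nabla f_{\sigma_{k+1}}(\mathbf{x}_k),\qquad k\ge 0.$$ Then for every $k\ge 1$, $$f(\mathbf{x}_k)-f(\mathbf{x}^\star)\le \frac{\|\mathbf{x}_0-\mathbf{x}^\star\|^2}{2tk}+\frac{Ld}{4k}\left(\sum_{i=1}^{k}\sigma_i^2+\sum_{i=2}^{k} i\,\max\big(0,\sigma_i^2-\sigma_{i-1}^2\big)\right).$$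
   Context: For a measurable $f:\mathbb{R}^d\to\mathbb{R}$ and $\sigma>0$, the Gaussian smoothing of $f$ with radius $\sigma$ is $f_\sigma(\mathbf{x})=\pi^{-d/2}\int_{\mathbb{R}^d} f(\mathbf{x}+\sigma\mathbf{u})\,e^{-\|\mathbf{u}\|_2^2}\,d\mathbf{u}$ (equivalently $\mathbb{E}_{\mathbf{u}\sim\mathcal N(0,I_d)}[f(\mathbf{x}+\sigma\sqrt2\,\mathbf{u})]$), and $f_0=f$. A function is $L$-smooth if it is differentiable and its gradient is $L$-Lipschitz in the Euclidean norm. *)

(* Defs.v *)
From HB Require Import structures.
From mathcomp Require Import all_boot all_order all_algebra.
From mathcomp Require Import all_classical all_reals all_analysis.
Set Implicit Arguments. Unset Strict Implicit. Unset Printing Implicit Defensive.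
Import Order.TTheory GRing.Theory Num.Theory.
Import numFieldNormedType.Exports.
Local Open Scope classical_set_scope.
Local Open Scope ring_scope.

Section Defs.
Variables (R : realType) (d : nat).

Definition sqnorm (x : 'rV[R]_d) : R := \sum_(i < d) x ord0 i ^+ 2.
Definition enorm (x : 'rV[R]_d) : R := Num.sqrt (sqnorm x).

Definition evec (i : 'I_d) : 'rV[R]_d := \row_j (if j == i then 1 else 0).

Definition grad (g : 'rV[R]_d -> R) (x : 'rV[R]_d) : 'rV[R]_d :=
  \row_i ('D_(evec i) g x).

Definition convex_fun (f : 'rV[R]_d -> R) : Prop :=
  forall (x y : 'rV[R]_d) (a : R), 0 <= a <= 1 ->
    f (a *: x + (1 - a) *: y) <= a * f x + (1 - a) * f y.

Definition L_smooth (L : R) (f : 'rV[R]_d -> R) : Prop :=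
  (forall x, differentiable f x) /\
  forall x y, enorm (grad f x - grad f y) <= L * enorm (x - y).

Definition is_minimizer (f : 'rV[R]_d -> R) (xs : 'rV[R]_d) : Prop :=
  forall x, f xs <= f x.

Definition setc (u : 'rV[R]_d) (k : nat) (s : R) : 'rV[R]_d :=
  \row_j (if nat_of_ord j == k then s else u ord0 j).

Fixpoint gauss_iter (k : nat) (g : 'rV[R]_d -> R) (u : 'rV[R]_d) : R :=
  match k with
  | 0 => g u
  | k'.+1 => Rintegral (@lebesgue_measure R) setT
      (fun s : R => (Num.sqrt pi)^-1 * expR (- s ^+ 2) * gauss_iter k' g (setc u k' s))
  end.

(* Gaussian smoothing f_sigma(x) = pi^{-d/2} \int_{R^d} f(x + sigma u) e^{-|u|^2} du,
   written as an iterated integral over the d coordinates *)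
Definition gsmooth (f : 'rV[R]_d -> R) (sigma : R) (x : 'rV[R]_d) : R :=
  gauss_iter d (fun u => f (x + sigma *: u)) 0.

End Defs.

(* Main.v *)
(* Write h(s) for the Gaussian mean of f(y + s u).  It is convex in s with its
   minimum at s = 0, so f_sigma(y) = h(sigma) is nondecreasing in sigma; applied
   to the convex function L/2 |. - y|^2 - f, and using E|u|^2 = d/2, the same
   argument gives f_sigma - f_tau <= (L d / 4)(sigma^2 - tau^2) for
   tau <= sigma.  Averaging the tangent and descent inequalities of f gives them
   for f_sigma, and identifies its gradient without differentiating under the
   integral.  A gradient step on f_{sigma_{k+1}} then satisfies
   f_{sigma_{k+1}}(x_{k+1}) - f_{sigma_{k+1}}(z)
     <= (|x_k - z|^2 - |x_{k+1} - z|^2) / (2 t);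
   taking z = x* and z = x_k gives the two inequalities that are telescoped. *)
Require Import Defs.
From HB Require Import structures.
From mathcomp Require Import all_boot all_order all_algebra.
From mathcomp Require Import all_classical all_reals all_analysis.
From mathcomp Require Import measurable_realfun ring lra.
Import Order.TTheory GRing.Theory Num.Theory.
Import numFieldNormedType.Exports.
Local Open Scope ring_scope.

(** * Functions of quadratic growth *)

Section QuadLip.
Context {R : realType}.

(* Stable under integration of one coordinate against the Gaussian, so that all
   the inner integrals of [gauss_iter] are integrable in the next variable. *)
Definition quad_lip {V : normedZmodType R} (g : V -> R) : Prop :=
  exists2 A : R, 0 <= A &
    forall u v, `|g u - g v| <= A * (1 + `|u| + `|v|) * `|u - v|.

Lemma quad_lipD {V : normedZmodType R} (g h : V -> R) :
  quad_lip g -> quad_lip h -> quad_lip (fun u => g u + h u).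
Proof.
move=> [A A0 gA] [B B0 hB]; exists (A + B); first exact: addr_ge0.
move=> u v; rewrite opprD addrACA (le_trans (ler_normD _ _))//.
by rewrite !mulrDl lerD.
Qed.

Lemma quad_lipZ {V : normedZmodType R} (a : R) (g : V -> R) :
  quad_lip g -> quad_lip (fun u => a * g u).
Proof.
move=> [A A0 gA]; exists (`|a| * A); first by rewrite mulr_ge0.
by move=> u v; rewrite -mulrBr normrM -!mulrA ler_wpM2l// mulrA.
Qed.

Lemma quad_lip_lip {V : normedZmodType R} (A : R) (g : V -> R) :
  0 <= A -> (forall u v, `|g u - g v| <= A * `|u - v|) -> quad_lip g.
Proof.
move=> A0 gA; exists A => // u v; apply: (le_trans (gA u v)).
by rewrite ler_wpM2r// ler_peMr// -addrA lerDl addr_ge0.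
Qed.

Lemma quad_lip_cst {V : normedZmodType R} (c : R) : quad_lip (fun _ : V => c).
Proof. by apply: (@quad_lip_lip V 0) => // u v; rewrite subrr normr0 mul0r. Qed.

Lemma quad_lip_sum {V : normedZmodType R} (I : Type) (r : seq I)
    (F : I -> V -> R) :
  (forall i, quad_lip (F i)) -> quad_lip (fun u => \sum_(i <- r) F i u).
Proof.
move=> qF; elim: r => [|i r IHr].
  by under eq_fun do rewrite big_nil; exact: quad_lip_cst.
by under eq_fun do rewrite big_cons; exact: quad_lipD.
Qed.

Lemma quad_lip_id : quad_lip (fun s : R => s).
Proof. by apply: (@quad_lip_lip R 1) => // u v; rewrite mul1r. Qed.

Lemma quad_lip_norm : quad_lip (fun s : R => `|s|).
Proof. by apply: (@quad_lip_lip R 1) => // u v; rewrite mul1r ler_dist_dist. Qed.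

Lemma quad_lip_sqr : quad_lip (fun s : R => s ^+ 2).
Proof.
exists 1 => // u v; rewrite mul1r subr_sqr normrM mulrC ler_wpM2r//.
by rewrite (le_trans (ler_normD _ _))// -addrA lerDr.
Qed.

(** A Lipschitz [h] grows at most linearly, |h u| <= |h 0| + B |u|, so the weight 1 + |h u| + |h v|
    is at most (1 + 2 |h 0| + B) times 1 + |u| + |v|. *)
Lemma quad_lip_comp {V W : normedZmodType R} (B : R) (h : W -> V) (g : V -> R) :
    0 <= B -> (forall u v, `|h u - h v| <= B * `|u - v|) ->
  quad_lip g -> quad_lip (g \o h).
Proof.
move=> B0 hB [A A0 gA].
have hn u : `|h u| <= `|h 0| + B * `|u|.
  by rewrite -[X in `|X|](subrK (h 0)) addrC (le_trans (ler_normD _ _))//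
    lerD2l -{2}(subr0 u).
exists (A * (1 + 2 * `|h 0| + B) * B).
  by rewrite !mulr_ge0// !addr_ge0// mulr_ge0.
move=> u v; apply: (le_trans (gA _ _)) => /=.
rewrite -!mulrA ler_wpM2l// [B * (_ * _)]mulrCA.
rewrite [leRHS]mulrA ler_pM//.
have := hn u; have := hn v; have := normr_ge0 (h 0); have := normr_ge0 u.
have := normr_ge0 v.
move: `|v| `|u| `|h 0| `|h v| `|h u| => a b c p q a0 b0 c0 pE qE.
have : 0 <= c * a by rewrite mulr_ge0.
have : 0 <= c * b by rewrite mulr_ge0.
lra.
Qed.

Lemma quad_lip_growth {V : normedZmodType R} (g : V -> R) : quad_lip g ->
  exists2 B : R, 0 <= B & forall u, `|g u| <= B * (1 + `|u| ^+ 2).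
Proof.
move=> [A A0 gA]; exists (`|g 0| + 2 * A); first by rewrite addr_ge0 ?mulr_ge0.
move=> u; rewrite -[X in `|X|](subrK (g 0)) (le_trans (ler_normD _ _))//.
have := gA u 0; rewrite normr0 addr0 subr0.
have := normr_ge0 u; have := normr_ge0 (g 0).
set x := `|u|; set y := `|g 0|; set z := `|_ - _| => y0 x0 h.
have : A * ((1 + x) * x) <= A * (2 * (1 + x ^+ 2)) by apply: ler_wpM2l => //; nra.
have : 0 <= y * x^+2 by rewrite mulr_ge0 ?sqr_ge0.
nra.
Qed.

Lemma quad_lip_continuous (g : R -> R) : quad_lip g -> continuous g.
Proof.
move=> [A A0 gA] x; apply/cvgrPdist_lt => e e0.
(* Within distance 1 of [x] one has |y| <= |x| + 1, so [K] is a local Lipschitz constant; the added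
   1 makes it positive. *)
pose K := A * (2 + 2 * `|x|) + 1.
have K0 : 0 < K by rewrite ltr_wpDl// mulr_ge0// addr_ge0// mulr_ge0.
exists (Num.min 1 (e / K)); first by rewrite /= lt_min ltr01 divr_gt0.
move=> y /=; rewrite lt_min => /andP[xy1 xyK].
apply: (le_lt_trans (gA x y)).
have yx : `|y| <= `|x| + 1.
  rewrite -[X in `|X|](subKr x) (le_trans (ler_normB _ _))// lerD2l ltW//.
apply: le_lt_trans (_ : K * `|x - y| < e); last by rewrite mulrC -ltr_pdivlMr.
rewrite ler_wpM2r// /K (le_trans (_ : _ <= A * (2 + 2 * `|x|))) ?lerDl//.
by rewrite ler_wpM2l//; lra.
Qed.

End QuadLip.

(** * Gaussian integrals *)

Section Gauss1.
Context {R : realType}.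
Notation mu := (@lebesgue_measure R).

(** Density of the normal law of mean 0 and variance 1/2, written as in [gauss_iter] so that
    [gauss_iterS] holds by conversion. *)
Definition gweight (s : R) : R := (Num.sqrt pi)^-1 * expR (- s ^+ 2).

Lemma gweight_ge0 s : 0 <= gweight s.
Proof. by rewrite mulr_ge0 ?invr_ge0 ?expR_ge0. Qed.

(** Transfers integrability and total mass from the normal law of variance 1 / (2 c^2) to translated
    and dilated copies of [gweight]. *)
Lemma normal_pdf_gweight (m c s : R) : 0 < c ->
  normal_pdf m (Num.sqrt 2 * c)^-1 s = c * gweight (c * (s - m)).
Proof.
move=> c0; have s20 : 0 < Num.sqrt (2 : R) by rewrite sqrtr_gt0.
rewrite normal_pdfE ?invr_neq0 ?mulf_neq0 ?gt_eqF// /normal_peak /normal_fun.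
have -> : (Num.sqrt 2 * c)^-1 ^+ 2 = (2 * c ^+ 2)^-1 :> R.
  by rewrite exprVn exprMn sqr_sqrtr.
rewrite /gweight [RHS]mulrA; congr (_ * expR _); last first.
  by field; rewrite gt_eqF.
have -> : (2 * c ^+ 2)^-1 * pi *+ 2 = c ^- 2 * pi :> R.
  by rewrite -mulr_natr; field; rewrite gt_eqF.
rewrite sqrtrM ?invr_ge0 ?sqr_ge0// -exprVn sqrtr_sqr invfM.
by rewrite ger0_norm ?invr_ge0 1?ltW// invrK.
Qed.

Lemma integrable_gweight_affine (m c : R) : 0 < c ->
  mu.-integrable setT (EFin \o (fun s => gweight (c * (s - m)))).
Proof.
move=> c0; have := integrable_normal_pdf m (Num.sqrt 2 * c)^-1.
move=> /(integrableZl measurableT c^-1); apply: eq_integrable => // s _ /=.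
by rewrite normal_pdf_gweight// -EFinM mulKf// gt_eqF.
Qed.

Lemma Rintegral_gweight_affine (m c : R) : 0 < c ->
  (\int[mu]_s gweight (c * (s - m)))%R = c^-1.
Proof.
move=> c0; have cV : c != 0 by rewrite gt_eqF.
apply: (mulfI cV); rewrite divff// -RintegralZl//; last first.
  exact: integrable_gweight_affine.
under eq_Rintegral do rewrite -normal_pdf_gweight//.
by rewrite /Rintegral integral_normal_pdf.
Qed.

Lemma measurable_gweight : measurable_fun setT gweight.
Proof.
by apply: measurable_funM => //; exact: measurable_gauss_fun.
Qed.

Lemma integrable_gweight_quad_lip (g : R -> R) : quad_lip g ->
  mu.-integrable setT (EFin \o (fun s => gweight s * g s)).
Proof.
move=> qg; have [B B0 gB] := quad_lip_growth g qg.
have c0 : 0 < (Num.sqrt 2)^-1 :> R by rewrite invr_gt0 sqrtr_gt0.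
have := integrableZl measurableT (2 * B) (integrable_gweight_affine 0 _ c0).
apply: le_integrable => //.
  apply/measurable_EFinP; apply: measurable_funM; first exact: measurable_gweight.
  exact: (continuous_measurable_fun (quad_lip_continuous _ qg)).
move=> s _ /=; rewrite lee_fin [leLHS]normrM [leRHS]normrM.
rewrite !(ger0_norm (gweight_ge0 _)) (@ger0_norm _ (2 * B)) ?mulr_ge0// subr0.
rewrite (le_trans (ler_wpM2l (gweight_ge0 _) (gB s)))// real_normK ?num_real//.
(* Half of the exponent absorbs the polynomial: 1 + s^2 <= 2 (1 + s^2 / 2) <= 2 exp(s^2 / 2). The
   dominating function is a wider Gaussian. *)
have key : expR (- s ^+ 2) * (1 + s ^+ 2) <=
    2 * expR (- ((Num.sqrt 2)^-1 * s) ^+ 2).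
  rewrite exprMn exprVn sqr_sqrtr//.
  have -> : - s ^+ 2 = - (2^-1 * s ^+ 2) + - (2^-1 * s ^+ 2) by lra.
  rewrite expRD -mulrA mulrC ler_wpM2r ?expR_ge0//.
  rewrite expRN mulrC ler_pdivrMr ?expR_gt0//.
  by have := expR_ge1Dx (2^-1 * s ^+ 2); have := sqr_ge0 s; nra.
have : 0 <= B * (Num.sqrt pi)^-1 by rewrite mulr_ge0 ?invr_ge0.
by move=> /ler_wpM2l /(_ _ _ key); congr (_ <= _); rewrite /gweight; ring.
Qed.

End Gauss1.

(** * The one-dimensional Gaussian mean and its first two moments *)

Section GMean.
Context {R : realType}.
Notation mu := (@lebesgue_measure R).

Definition gmean (g : R -> R) : R := \int[mu]_s (gweight s * g s).

Lemma gmeanD (g h : R -> R) : quad_lip g -> quad_lip h ->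
  gmean (fun s => g s + h s) = gmean g + gmean h.
Proof.
move=> qg qh; rewrite /gmean -RintegralD//; first last.
- exact: integrable_gweight_quad_lip.
- exact: integrable_gweight_quad_lip.
by under eq_Rintegral do rewrite mulrDr.
Qed.

Lemma gmeanZ (a : R) (g : R -> R) : quad_lip g ->
  gmean (fun s => a * g s) = a * gmean g.
Proof.
move=> qg; rewrite /gmean -RintegralZl//; last exact: integrable_gweight_quad_lip.
by under eq_Rintegral do rewrite mulrCA.
Qed.

Lemma ler_gmean (g h : R -> R) : quad_lip g -> quad_lip h ->
  (forall s, g s <= h s) -> gmean g <= gmean h.
Proof.
move=> qg qh gh; apply: le_Rintegral => //.
- exact: integrable_gweight_quad_lip.
- exact: integrable_gweight_quad_lip.
by move=> s _; rewrite ler_wpM2l// gweight_ge0.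
Qed.

Lemma gmean_cst (c : R) : gmean (fun=> c) = c.
Proof.
have int1 : mu.-integrable setT (EFin \o (gweight : R -> R)).
  have := integrable_gweight_affine (0 : R) 1 ltr01.
  by apply: eq_integrable => // s _ /=; rewrite mul1r subr0.
rewrite /gmean RintegralZr// -[RHS]mul1r; congr (_ * _).
rewrite -[RHS]invr1 -(Rintegral_gweight_affine 0 1 ltr01).
by apply: eq_Rintegral => s _; rewrite mul1r subr0.
Qed.

(* Translating the Gaussian by [a] keeps its mass 1 and multiplies it by
   [expR (2 a s - a ^ 2) >= 1 + 2 a s - a ^ 2], so [2 a gmean id <= a ^ 2]. *)
Lemma gmean_id : gmean id = 0.
Proof.
have bnd a : 2 * a * gmean id <= a ^+ 2.
  have q1 : quad_lip (fun s : R => 2 * a * s) by apply: quad_lipZ; exact: quad_lip_id.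
  have q2 : quad_lip (fun s : R => 2 * a * s + (1 - a ^+ 2)).
    by apply: quad_lipD => //; exact: quad_lip_cst.
  have : gmean (fun s => 2 * a * s + (1 - a ^+ 2)) <= 1.
    rewrite -[leRHS]invr1 -(Rintegral_gweight_affine a 1 ltr01).
    apply: le_Rintegral => //; first exact: integrable_gweight_quad_lip.
      exact: integrable_gweight_affine.
    move=> s _; rewrite /gweight mul1r -[leLHS]mulrA ler_wpM2l ?invr_ge0//.
    have -> : - (s - a) ^+ 2 = - s ^+ 2 + (2 * a * s - a ^+ 2) by ring.
    rewrite expRD ler_wpM2l ?expR_ge0//.
    by rewrite addrCA (le_trans _ (expR_ge1Dx _)).
  rewrite gmeanD//; last exact: quad_lip_cst.
  rewrite gmeanZ; last exact: quad_lip_id.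
  by rewrite gmean_cst; lra.
(* For [a := gmean id] the bound reads 2 a^2 <= a^2, which forces a = 0. *)
by have := bnd (gmean id); have := bnd (- gmean id); nra.
Qed.

(* Dilating by [c] gives mass [1 / c] and multiplies the Gaussian by
   [expR ((1 - c ^ 2) s ^ 2) >= 1 + (1 - c ^ 2) s ^ 2]; let [c] tend to 1. *)
Lemma gmean_sqr : gmean (fun s => s ^+ 2) = 2^-1.
Proof.
set v := gmean _.
have bnd c : 0 < c -> 1 - (c ^+ 2 - 1) * v <= c^-1.
  move=> c0.
  have q1 : quad_lip (fun s : R => (1 - c ^+ 2) * s ^+ 2).
    by apply: quad_lipZ; exact: quad_lip_sqr.
  have q2 : quad_lip (fun s : R => (1 - c ^+ 2) * s ^+ 2 + 1).
    by apply: quad_lipD => //; exact: quad_lip_cst.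
  have : gmean (fun s => (1 - c ^+ 2) * s ^+ 2 + 1) <= c^-1.
    rewrite -(Rintegral_gweight_affine 0 c c0).
    apply: le_Rintegral => //; first exact: integrable_gweight_quad_lip.
      exact: integrable_gweight_affine.
    move=> s _; rewrite /gweight -[leLHS]mulrA ler_wpM2l ?invr_ge0//.
    have -> : - (c * (s - 0)) ^+ 2 = - s ^+ 2 + (1 - c ^+ 2) * s ^+ 2 by ring.
    by rewrite expRD ler_wpM2l ?expR_ge0// addrC expR_ge1Dx.
  rewrite gmeanD//; last exact: quad_lip_cst.
  rewrite gmeanZ; last exact: quad_lip_sqr.
  by rewrite gmean_cst -/v; lra.
(* Multiplying [bnd] by [c] brings out the factor 1 - c; values of [c] below 1 then bound [v] from
   above, values beyond 1 from below. *)
have bnd' c : 0 < c -> 0 <= (1 - c) * (1 - c * (c + 1) * v).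
  move=> c0; have := bnd c c0.
  by rewrite -[c^-1]mul1r ler_pdivlMr//; nra.
have v0 : 0 <= v.
  by apply: Rintegral_ge0 => s _; rewrite mulr_ge0 ?gweight_ge0 ?sqr_ge0.
apply/eqP; rewrite eq_le; apply/andP; split; rewrite leNgt; apply/negP => vlt.
(* Suppose v > 1/2 and take c = 1 - e. The choice of [e] makes 3 e v half of 2 v - 1, so the second
   factor -(2 v - 1) + 3 e v - e^2 v is negative. *)
- pose e := (2 * v - 1) / (6 * v).
  have ve : e * v = (2 * v - 1) / 6 by rewrite /e; field; lra.
  have e0 : 0 < e by rewrite divr_gt0//; lra.
  have e1 : e < 1 by rewrite ltr_pdivrMr; lra.
  have : 0 <= e * (1 - (1 - e) * (2 - e) * v).
    have -> : e * (1 - (1 - e) * (2 - e) * v) =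
      (1 - (1 - e)) * (1 - (1 - e) * (1 - e + 1) * v) by ring.
    by apply: bnd'; lra.
  rewrite pmulr_rge0//.
  have -> : (1 - e) * (2 - e) * v = 2 * v - 3 * (e * v) + e * (e * v) by ring.
  have : 0 <= e * (e * v) by rewrite mulrA mulr_ge0// -expr2 sqr_ge0.
  rewrite {1 2}ve => h1 h2; nra.
(* Suppose v < 1/2 and take c = 1 + e. As e <= 1/4, the excess 3 e v + e^2 v stays below 4 e = 1 - 2
   v. *)
- pose e := (1 - 2 * v) / 4.
  have e0 : 0 < e by rewrite /e; lra.
  have : e * (1 - (1 + e) * (2 + e) * v) <= 0.
    rewrite -oppr_ge0.
    have -> : - (e * (1 - (1 + e) * (2 + e) * v)) =
      (1 - (1 + e)) * (1 - (1 + e) * (1 + e + 1) * v) by ring.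
    by apply: bnd'; lra.
  by rewrite pmulr_rle0// /e; nra.
Qed.
End GMean.

(** * The max norm on row vectors and the integration of one coordinate *)

Section RowNorm.
Context {R : realType} {d : nat}.
Implicit Types u v : 'rV[R]_d.

Lemma rV_norm_le u (c : R) : 0 <= c -> (forall j, `|u ord0 j| <= c) -> `|u| <= c.
Proof.
move=> c0 uc; rewrite [leLHS]/Num.norm /= mx_normrE; apply/bigmax_leP.
by split=> // -[i j] _ /=; rewrite ord1.
Qed.

Lemma ler_rV_norm u j : `|u ord0 j| <= `|u|.
Proof.
rewrite [leRHS]/Num.norm /= mx_normrE.
by apply: (le_bigmax _ (fun ij : 'I_1 * 'I_d => `|u ij.1 ij.2|) (ord0, j)).
Qed.

Lemma setc_dist u v k (s : R) : `|setc u k s - setc v k s| <= `|u - v|.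
Proof.
apply: rV_norm_le => // j; rewrite !mxE.
case: ifP => _; first by rewrite subrr normr0.
by have := ler_rV_norm (u - v) j; rewrite !mxE.
Qed.

Lemma setc_distr u k (s t : R) : `|setc u k s - setc u k t| <= `|s - t|.
Proof.
apply: rV_norm_le => // j; rewrite !mxE.
by case: ifP => _ //; rewrite subrr normr0.
Qed.

Lemma setc_norm u k (s : R) : `|setc u k s| <= `|u| + `|s|.
Proof.
apply: rV_norm_le => [|j]; first exact: addr_ge0.
rewrite mxE; case: ifP => _; first by rewrite lerDr.
by rewrite (le_trans (ler_rV_norm _ _))// lerDl.
Qed.

Lemma quad_lip_setc (g : 'rV[R]_d -> R) u k :
  quad_lip g -> quad_lip (fun s : R => g (setc u k s)).
Proof.
apply: (@quad_lip_comp R 'rV[R]_d R 1 (fun s => setc u k s)) => // s t.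
by rewrite mul1r setc_distr.
Qed.

(** Overwriting a coordinate by s does not increase distances and adds at most |s| to each norm, so
    averaging costs only the finite mean [M] of |s|. *)
Lemma quad_lip_gmean_setc (g : 'rV[R]_d -> R) k : quad_lip g ->
  quad_lip (fun u => gmean (fun s => g (setc u k s))).
Proof.
move=> qg; have [A A0 gA] := qg; set M := gmean (fun s : R => `|s|).
have M0 : 0 <= M by apply: Rintegral_ge0 => s _; rewrite mulr_ge0 ?gweight_ge0.
have half u v :
    gmean (fun s => g (setc u k s)) - gmean (fun s => g (setc v k s)) <=
    A * (1 + `|u| + `|v|) * `|u - v| + 2 * A * `|u - v| * M.
  set a := A * (1 + _ + _) * _; set b := 2 * A * _.
  have qM : quad_lip (fun s : R => b * `|s|) by apply/quad_lipZ/quad_lip_norm.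
  have qa : quad_lip (fun s : R => a + b * `|s|).
    by apply: quad_lipD => //; exact: quad_lip_cst.
  have -> : a + b * M = gmean (fun s => a + b * `|s|).
    rewrite gmeanD ?gmean_cst ?gmeanZ//; first exact: quad_lip_norm.
    exact: quad_lip_cst.
  rewrite lerBlDl -gmeanD//; last exact: quad_lip_setc.
  apply: ler_gmean; first exact: quad_lip_setc.
    by apply: quad_lipD => //; exact: quad_lip_setc.
  move=> s; rewrite -lerBlDl (le_trans (ler_norm _))// (le_trans (gA _ _))//.
  have -> : a + b * `|s| = A * (1 + `|u| + `|v| + 2 * `|s|) * `|u - v|.
    by rewrite /a /b; ring.
  apply: ler_pM => //; last exact: setc_dist.
    by rewrite mulr_ge0// !addr_ge0.
  rewrite ler_wpM2l//; have := setc_norm u k s; have := setc_norm v k s; lra.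
exists (A + 2 * A * M) => [|u v]; first by rewrite addr_ge0// !mulr_ge0.
have le : A * (1 + `|u| + `|v|) * `|u - v| + 2 * A * `|u - v| * M <=
    (A + 2 * A * M) * (1 + `|u| + `|v|) * `|u - v|.
  have : 0 <= 2 * A * M * `|u - v| * (`|u| + `|v|) by rewrite !mulr_ge0// addr_ge0.
  lra.
rewrite ler_norml; apply/andP; split; last exact: le_trans (half u v) le.
by rewrite lerNl opprB (le_trans (half v u))// distrC (addrAC 1).
Qed.
End RowNorm.

(** * The Gaussian expectation in d variables and its moments *)

Section GaussIter.
Context {R : realType} {d : nat}.
Implicit Types (g h : 'rV[R]_d -> R) (u v : 'rV[R]_d).

Lemma gauss_iterS k g u :
  gauss_iter k.+1 g u = gmean (fun s => gauss_iter k g (setc u k s)).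
Proof. by []. Qed.

Lemma quad_lip_gauss_iter k g : quad_lip g -> quad_lip (gauss_iter k g).
Proof. by move=> qg; elim: k => //= k; exact: quad_lip_gmean_setc. Qed.

Lemma gauss_iterD k g h : quad_lip g -> quad_lip h ->
  gauss_iter k (fun u => g u + h u) =
  fun u => gauss_iter k g u + gauss_iter k h u.
Proof.
move=> qg qh; elim: k => // k IHk; apply/funext => u; rewrite !gauss_iterS IHk.
by rewrite gmeanD//; exact/quad_lip_setc/quad_lip_gauss_iter.
Qed.

Lemma gauss_iterZ k a g : quad_lip g ->
  gauss_iter k (fun u => a * g u) = fun u => a * gauss_iter k g u.
Proof.
move=> qg; elim: k => // k IHk; apply/funext => u; rewrite !gauss_iterS IHk.
by rewrite gmeanZ//; exact/quad_lip_setc/quad_lip_gauss_iter.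
Qed.

Lemma ler_gauss_iter k g h u : quad_lip g -> quad_lip h ->
  (forall v, g v <= h v) -> gauss_iter k g u <= gauss_iter k h u.
Proof.
move=> qg qh gh; elim: k u => // k IHk u; rewrite !gauss_iterS.
by apply: ler_gmean => //; exact/quad_lip_setc/quad_lip_gauss_iter.
Qed.

Lemma gauss_iter_cst k (c : R) u : gauss_iter k (fun=> c) u = c.
Proof.
elim: k u => // k IHk u; rewrite gauss_iterS.
by under eq_fun do rewrite IHk; rewrite gmean_cst.
Qed.

(** Stage [k] integrates out exactly the coordinates below [k]; every integral over a coordinate
    other than [i] sees a constant and has mass 1. *)
Lemma gauss_iter_coord k (phi : R -> R) (i : 'I_d) u :
  gauss_iter k (fun u => phi (u ord0 i)) u =
  if (i < k)%N then gmean phi else phi (u ord0 i).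
Proof.
elim: k u => // k IHk u; rewrite gauss_iterS; under eq_fun do rewrite IHk mxE.
by rewrite ltnS; case: (ltngtP i k) => ik //; rewrite gmean_cst.
Qed.

(** Expectation under independent centred Gaussian coordinates of variance 1/2; [gsmooth f s x]
    unfolds to [gexp (fun u => f (x + s *: u))]. *)
Definition gexp g : R := gauss_iter d g 0.

Lemma gexpD g h : quad_lip g -> quad_lip h ->
  gexp (fun u => g u + h u) = gexp g + gexp h.
Proof. by move=> qg qh; rewrite /gexp gauss_iterD. Qed.

Lemma gexpZ a g : quad_lip g -> gexp (fun u => a * g u) = a * gexp g.
Proof. by move=> qg; rewrite /gexp gauss_iterZ. Qed.

Lemma ler_gexp g h : quad_lip g -> quad_lip h ->
  (forall u, g u <= h u) -> gexp g <= gexp h.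
Proof. exact: ler_gauss_iter. Qed.

Lemma gexp_cst (c : R) : gexp (fun=> c) = c.
Proof. exact: gauss_iter_cst. Qed.

Lemma gexp_sum (I : Type) (r : seq I) (F : I -> 'rV[R]_d -> R) :
  (forall i, quad_lip (F i)) ->
  gexp (fun u => \sum_(i <- r) F i u) = \sum_(i <- r) gexp (F i).
Proof.
move=> qF; elim: r => [|i r IHr].
  by under eq_fun do rewrite big_nil; rewrite gexp_cst big_nil.
under eq_fun do rewrite big_cons.
by rewrite gexpD ?IHr ?big_cons//; exact: quad_lip_sum.
Qed.

Lemma quad_lip_coord (i : 'I_d) : quad_lip (fun u => u ord0 i).
Proof.
apply: (@quad_lip_lip R _ 1) => // u v; rewrite mul1r.
by have := ler_rV_norm (u - v) i; rewrite !mxE.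
Qed.

Lemma quad_lip_coord_sqr (i : 'I_d) : quad_lip (fun u => u ord0 i ^+ 2).
Proof.
apply: (@quad_lip_comp R R 'rV[R]_d 1 (fun u => u ord0 i)) quad_lip_sqr => // u v.
by rewrite mul1r; have := ler_rV_norm (u - v) i; rewrite !mxE.
Qed.

Lemma quad_lip_sqnorm : quad_lip (@sqnorm R d).
Proof. by apply: quad_lip_sum => i; exact: quad_lip_coord_sqr. Qed.

Lemma gexp_sqnorm : gexp (@sqnorm R d) = d%:R / 2.
Proof.
rewrite gexp_sum; last exact: quad_lip_coord_sqr.
under eq_bigr => i _ do
  rewrite /gexp (gauss_iter_coord d (fun s => s ^+ 2)) ltn_ord gmean_sqr.
by rewrite sumr_const card_ord mulr_natl.
Qed.

Definition dot u v : R := \sum_(i < d) u ord0 i * v ord0 i.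

Lemma quad_lip_dot u : quad_lip (dot u).
Proof. by apply: quad_lip_sum => i; apply/quad_lipZ/quad_lip_coord. Qed.

Lemma gexp_dot u : gexp (dot u) = 0.
Proof.
rewrite gexp_sum; last by move=> i; apply/quad_lipZ/quad_lip_coord.
apply: big1 => i _; rewrite gexpZ; last exact: quad_lip_coord.
by rewrite /gexp (gauss_iter_coord d id) ltn_ord gmean_id mulr0.
Qed.

End GaussIter.

(** * Smooth convex functions *)

Section Euclid.
Context {R : realType} {d : nat}.
Implicit Types u v w : 'rV[R]_d.

Lemma sqnorm_ge0 u : 0 <= sqnorm u.
Proof. by apply: sumr_ge0 => i _; exact: sqr_ge0. Qed.

Lemma sqr_enorm u : enorm u ^+ 2 = sqnorm u.
Proof. by rewrite sqr_sqrtr// sqnorm_ge0. Qed.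

Lemma sqnormZ c u : sqnorm (c *: u) = c ^+ 2 * sqnorm u.
Proof. by rewrite /sqnorm mulr_sumr; apply: eq_bigr => i _; rewrite mxE exprMn. Qed.

Lemma sqnormD u v : sqnorm (u + v) = sqnorm u + 2 * dot u v + sqnorm v.
Proof.
rewrite /sqnorm /dot mulr_sumr -!big_split; apply: eq_bigr => i _ /=.
by rewrite mxE; ring.
Qed.

Lemma dotZr c u v : dot u (c *: v) = c * dot u v.
Proof. by rewrite /dot mulr_sumr; apply: eq_bigr => i _ /=; rewrite mxE mulrCA. Qed.

Lemma dotBl u v w : dot (u - v) w = dot u w - dot v w.
Proof. by rewrite /dot -sumrB; apply: eq_bigr => i _ /=; rewrite !mxE mulrBl. Qed.

Lemma dotuu u : dot u u = sqnorm u.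
Proof. by apply: eq_bigr => i _; rewrite expr2. Qed.

Lemma dot_evec u i : dot u (evec R i) = u ord0 i.
Proof.
rewrite /dot (bigD1 i)//= big1 => [|j ji]; first by rewrite mxE eqxx mulr1 addr0.
by rewrite mxE (negPf ji) mulr0.
Qed.

Lemma sqnorm_evec (i : 'I_d) : sqnorm (evec R i) = 1.
Proof. by rewrite -dotuu dot_evec mxE eqxx. Qed.

Lemma rV_evecE u : u = \sum_(i < d) u ord0 i *: evec R i.
Proof.
apply/rowP => j; rewrite summxE (bigD1 j)//= big1 => [|i ij].
  by rewrite !mxE eqxx mulr1 addr0.
by rewrite !mxE eq_sym (negPf ij) mulr0.
Qed.

(** Completing the square in each coordinate. It stands in for Cauchy-Schwarz in [descent]. *)
Lemma dot_young c u v : 0 < c ->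
  dot u v <= (c^-1 * sqnorm u + c * sqnorm v) / 2.
Proof.
move=> c0; rewrite /sqnorm /dot !mulr_sumr -big_split mulr_suml ler_sum// => i _ /=.
rewrite -subr_ge0; set a := u _ _; set b := v _ _.
have -> : (c^-1 * a ^+ 2 + c * b ^+ 2) / 2 - a * b = c^-1 * (a - c * b) ^+ 2 / 2.
  by field; rewrite gt_eqF.
by rewrite mulr_ge0// mulr_ge0 ?sqr_ge0// invr_ge0 ltW.
Qed.

Lemma abs_coord_enorm u i : `|u ord0 i| <= enorm u.
Proof.
rewrite -sqrtr_sqr ler_wsqrtr// /sqnorm (bigD1 i)//= lerDl.
by apply: sumr_ge0 => j _; exact: sqr_ge0.
Qed.

(** The norm used by [quad_lip] on row vectors is the max norm; this converts the Euclidean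
    Lipschitz bound on the gradient to it. *)
Lemma enorm_le_norm u : enorm u <= Num.sqrt d%:R * `|u|.
Proof.
rewrite -[X in _ * X]ger0_norm// -sqrtr_sqr -sqrtrM// ler_wsqrtr//.
rewrite mulr_natl -[X in _ *+ X]card_ord -sumr_const ler_sum// => i _.
by rewrite -real_normK ?num_real// lerXn2r ?nnegrE// ler_rV_norm.
Qed.

End Euclid.

(** * Tangent and descent inequalities *)

Section SmoothConvex.
Local Open Scope classical_set_scope.
Context {R : realType} {d : nat}.
Variables (f : 'rV[R]_d -> R).
Implicit Types x y z v : 'rV[R]_d.

Lemma derive_dot_grad x v : differentiable f x -> 'D_v f x = dot (grad f x) v.
Proof.
move=> df; rewrite deriveE// [v in LHS]rV_evecE linear_sum; apply: eq_bigr => i _.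
by rewrite linearZ /= -deriveE// mxE mulrC.
Qed.

(** For 0 < h <= 1, convexity bounds the difference quotient from [x] towards [z] by f z - f x; then
    h tends to 0 from the right. *)
Lemma convex_tangent x z : convex_fun f -> differentiable f x ->
  f x + dot (grad f x) (z - x) <= f z.
Proof.
move=> cf df; rewrite -derive_dot_grad// addrC -lerBrDr.
have : derivable f x (z - x) by exact: (diff_derivable df).
rewrite /derivable => /cvg_dnbhs_at_right flr.
apply: (cvgr_to_le flr).
near=> h.
have h0 : 0 < h by near: h; exact: nbhs_right_gt.
have h1 : h <= 1 by near: h; apply: nbhs_right_le.
rewrite /= -[_ *: _]/(h^-1 * _) mulrC ler_pdivrMr//.
have -> : h *: (z - x) + x = h *: z + (1 - h) *: x.
  by rewrite scalerBr scalerBl scale1r -addrA [- _ + _]addrC.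
have h01 : 0 <= h <= 1 by rewrite ltW.
by have := cf z x h h01; lra.
Unshelve. all: by end_near. Qed.

Lemma is_derive_line x v s : derivable f (s *: v + x) v ->
  is_derive s (1 : R) (fun s : R => f (s *: v + x)) ('D_v f (s *: v + x)).
Proof.
pose F (s : R) := f (s *: v + x).
have E : (fun h : R => h^-1 *: ((F \o shift s) (h *: 1) - F s)) =
  (fun h : R => h^-1 *: ((f \o shift (s *: v + x)) (h *: v) - f (s *: v + x))).
  by apply/funext => h /=; rewrite /F [h *: 1]mulr1 scalerDl addrA.
by move=> df; split; rewrite /derivable /derive E.
Qed.

(** The mean value theorem on [0, 1] for [F], which is f along the segment minus the claimed
    quadratic bound; it suffices that [F'] is nonpositive inside. *)
Lemma descent L x v : 0 < L -> L_smooth L f ->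
  f (x + v) <= f x + dot (grad f x) v + L / 2 * sqnorm v.
Proof.
move=> L0 [df lipf].
pose a := dot (grad f x) v; pose K := L / 2 * sqnorm v.
pose F (s : R) := f (s *: v + x) - a * s - K * s ^+ 2.
pose F' (s : R) := 'D_v f (s *: v + x) - a - K * (2 * s).
have F'E s : is_derive s (1 : R) F (F' s).
  have D1 := @is_derive_line x v s (diff_derivable (df _)).
  have D2 := @is_deriveZ _ _ _ id a s 1 1 (is_derive_id s (1 : R)).
  have D3 := @is_deriveZ _ _ _ _ K s 1 _ (is_deriveX 2 (is_derive_id s (1 : R))).
  apply: (is_derive_eq (is_deriveB (is_deriveB D1 D2) D3)).
  by rewrite /F' /GRing.scale /=; ring.
have Fc : {within `[(0 : R), 1], continuous F}.
  apply: derivable_within_continuous => s _.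
  exact: (@ex_derive _ _ _ _ _ _ _ (F'E s)).
have [c c01] := @MVT R F F' 0 1 ltr01 (fun s _ => F'E s) Fc.
rewrite subr0 mulr1 /F scale1r scale0r add0r [v + x]addrC => FE.
suff : F' c <= 0 by rewrite -FE -/a -/K; lra.
move: c01; rewrite in_itv /= => /andP[c0 _].
rewrite /F' derive_dot_grad// /a -dotBl.
(* The gradient difference has norm at most L c |v|; Young's inequality with weight L c balances its
   two terms and gives exactly 2 K c. *)
have Lc0 : 0 < L * c by rewrite mulr_gt0.
have := dot_young _ (grad f (c *: v + x) - grad f x) v Lc0.
suff : sqnorm (grad f (c *: v + x) - grad f x) <= (L * c) ^+ 2 * sqnorm v.
  move=> /(ler_wpM2l (ltW (_ : 0 < (L * c)^-1))); rewrite invr_gt0 => /(_ Lc0).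
  by rewrite expr2 -mulrA mulKf ?gt_eqF// /K; lra.
rewrite exprMn -mulrA -sqnormZ -!sqr_enorm -exprMn lerXn2r ?nnegrE ?sqrtr_ge0//.
  by rewrite mulr_ge0 ?sqrtr_ge0 ?ltW.
by rewrite (le_trans (lipf _ _))// addrK.
Qed.
End SmoothConvex.

(** * Gaussian smoothing *)

Section Smoothing.
Context {R : realType} {d : nat}.
Variables (f : 'rV[R]_d -> R) (L : R).
Hypotheses (L0 : 0 < L) (cf : convex_fun f) (sf : L_smooth L f).
Implicit Types x y z u v : 'rV[R]_d.

Lemma grad_coord_lip x y i :
  `|grad f x ord0 i - grad f y ord0 i| <= L * Num.sqrt d%:R * `|x - y|.
Proof.
have := abs_coord_enorm (grad f x - grad f y) i; rewrite !mxE => /le_trans; apply.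
rewrite (le_trans (sf.2 x y))// -mulrA ler_wpM2l ?(ltW L0)//; exact: enorm_le_norm.
Qed.

Lemma quad_lip_grad i : quad_lip (fun x => grad f x ord0 i).
Proof.
by apply: (@quad_lip_lip R _ (L * Num.sqrt d%:R)) => [|u v];
  [rewrite mulr_ge0 ?sqrtr_ge0 ?ltW|exact: grad_coord_lip].
Qed.

(** The tangent inequality at [x] bounds f x - f y by the pairing of grad f x with x - y, and a
    Lipschitz gradient grows at most linearly. *)
Lemma quad_lip_smooth : quad_lip f.
Proof.
pose B := enorm (grad f 0); pose C := L * Num.sqrt d%:R.
have B0 : 0 <= B by exact: sqrtr_ge0.
have C0 : 0 <= C by rewrite mulr_ge0 ?sqrtr_ge0 ?ltW.
have half x y : f x - f y <= d%:R * (C + B) * (1 + `|x| + `|y|) * `|x - y|.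
  have := @convex_tangent _ _ f x y cf (sf.1 x).
  rewrite -lerBrDl -opprB -scaleN1r dotZr mulN1r -(opprB (f x)) lerN2.
  move=> /le_trans; apply.
  rewrite -!mulrA mulr_natl -[X in _ *+ X]card_ord -sumr_const ler_sum// => i _.
  rewrite (le_trans (ler_norm _))// normrM mulrA ler_pM//; last first.
    by have := ler_rV_norm (x - y) i; rewrite !mxE.
  rewrite -[grad f x _ _](subrK (grad f 0 ord0 i)) (le_trans (ler_normD _ _))//.
  have := abs_coord_enorm (grad f 0) i; have := grad_coord_lip x 0 i.
  rewrite subr0 -/B -/C => h1 h2; rewrite (le_trans (lerD h1 h2))//.
  have : 0 <= B * (`|x| + `|y|) by rewrite mulr_ge0// addr_ge0.
  have : 0 <= C * (1 + `|y|) by rewrite mulr_ge0// addr_ge0.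
  lra.
exists (d%:R * (C + B)) => [|x y]; first by rewrite mulr_ge0// addr_ge0.
rewrite ler_norml half andbT lerNl opprB (le_trans (half y x))//.
by rewrite distrC (addrAC 1).
Qed.

Lemma quad_lip_affine (g : 'rV[R]_d -> R) x s :
  quad_lip g -> quad_lip (fun u => g (x + s *: u)).
Proof.
apply: (@quad_lip_comp R 'rV[R]_d 'rV[R]_d `|s| (fun u => x + s *: u)) => // u v.
by rewrite opprD addrACA subrr add0r -scalerBr normrZ.
Qed.

(** The averaged gradient, shown in [grad_gsmooth] to be the gradient of [gsmooth f s]. *)
Definition gsmooth_grad (s : R) x : 'rV[R]_d :=
  \row_i gexp (fun u => grad f (x + s *: u) ord0 i).

Lemma gexp_affine_grad s x v :
  quad_lip (fun u => f (x + s *: u) + dot (grad f (x + s *: u)) v) /\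
  gexp (fun u => f (x + s *: u) + dot (grad f (x + s *: u)) v) =
    gsmooth f s x + dot (gsmooth_grad s x) v.
Proof.
have E : (fun u => dot (grad f (x + s *: u)) v) =
         (fun u => \sum_(i < d) v ord0 i * grad f (x + s *: u) ord0 i).
  by apply/funext => u; apply: eq_bigr => i _; rewrite mulrC.
have qi i : quad_lip (fun u => grad f (x + s *: u) ord0 i).
  exact: (@quad_lip_affine (fun x => grad f x ord0 i) x s (quad_lip_grad i)).
have qd : quad_lip (fun u => dot (grad f (x + s *: u)) v).
  by rewrite E; apply: quad_lip_sum => i; exact: quad_lipZ.
have qf := quad_lip_affine f x s quad_lip_smooth.
split; first exact: quad_lipD.
rewrite gexpD// E gexp_sum => [|i]; last exact: quad_lipZ.
by congr (_ + _); apply: eq_bigr => i _; rewrite gexpZ// mxE mulrC.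
Qed.

Lemma gsmooth_tangent s x v :
  gsmooth f s x + dot (gsmooth_grad s x) v <= gsmooth f s (x + v).
Proof.
have [q <-] := gexp_affine_grad s x v.
apply: ler_gexp => //; first exact: quad_lip_affine quad_lip_smooth.
move=> u; have := @convex_tangent _ _ f (x + s *: u) (x + v + s *: u) cf (sf.1 _).
by rewrite opprD addrACA subrr addr0 [x + v]addrC addrK.
Qed.

Lemma gsmooth_descent s x v :
  gsmooth f s (x + v) <=
    gsmooth f s x + dot (gsmooth_grad s x) v + L / 2 * sqnorm v.
Proof.
have [q <-] := gexp_affine_grad s x v.
rewrite -[X in _ <= _ + X](@gexp_cst R d) -gexpD//; last exact: quad_lip_cst.
apply: ler_gexp; first exact: quad_lip_affine quad_lip_smooth.
  by apply: quad_lipD => //; exact: quad_lip_cst.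
by move=> u; rewrite addrAC; exact: descent.
Qed.

(** Along [h *: evec R i] a quadratic remainder leaves an error of at most |K| |h| in the difference
    quotient. *)
Lemma grad_eq (g : 'rV[R]_d -> R) x (p : 'rV[R]_d) (K : R) :
    (forall v, `|g (x + v) - g x - dot p v| <= K * sqnorm v) ->
  grad g x = p.
Proof.
move=> gp; apply/rowP => i; rewrite mxE; apply: cvg_lim => //.
apply/cvgrPdist_le => e e0; near=> h.
have h0 : h != 0 by near: h; exact: nbhs_dnbhs_neq.
have hK : `|h| <= e / (`|K| + 1).
  near: h; apply: dnbhs0_le; rewrite divr_gt0// ltr_wpDl//.
rewrite /= [h *: _ + x]addrC -[h^-1 *: _]/(h^-1 * _) distrC.
have := gp (h *: evec R i); rewrite dotZr dot_evec sqnormZ sqnorm_evec mulr1.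
set a := g _ - g x => ha.
have -> : h^-1 * a - p ord0 i = h^-1 * (a - h * p ord0 i) by field.
rewrite normrM normfV ler_pdivrMl ?normr_gt0// (le_trans ha)//.
rewrite -[h ^+ 2]real_normK ?num_real// expr2 mulrCA ler_wpM2l//.
rewrite (le_trans (_ : _ <= (`|K| + 1) * `|h|))//.
  by rewrite ler_wpM2r// (le_trans (ler_norm _))// lerDl.
by rewrite mulrC -ler_pdivlMr// ltr_wpDl.
Unshelve. all: by end_near. Qed.

(** The averaged tangent and descent inequalities put the first-order remainder between 0 and L / 2
    |v|^2. *)
Lemma grad_gsmooth s x : grad (gsmooth f s) x = gsmooth_grad s x.
Proof.
apply: (grad_eq _ _ _ (L / 2)) => v.
have := gsmooth_tangent s x v; have := gsmooth_descent s x v.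
have : 0 <= L / 2 * sqnorm v by rewrite mulr_ge0 ?sqnorm_ge0// divr_ge0// ltW.
by rewrite ler_norml => *; apply/andP; split; lra.
Qed.

(** Jensen's inequality: average the tangent inequality at [y], whose linear term has mean zero. *)
Lemma le_gsmooth s y : f y <= gsmooth f s y.
Proof.
have q : quad_lip (fun u => f y + s * dot (grad f y) u).
  by apply: quad_lipD; [exact: quad_lip_cst|apply/quad_lipZ/quad_lip_dot].
have -> : f y = gexp (fun u => f y + s * dot (grad f y) u).
  rewrite gexpD ?gexp_cst; [|exact: quad_lip_cst|by apply/quad_lipZ/quad_lip_dot].
  by rewrite gexpZ ?gexp_dot ?mulr0 ?addr0//; exact: quad_lip_dot.
apply: ler_gexp => //; first exact: quad_lip_affine quad_lip_smooth.
move=> u; have := @convex_tangent _ _ f y (y + s *: u) cf (sf.1 y).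
by rewrite [y + _]addrC addrK dotZr.
Qed.

(** Average the descent inequality at [y]; the second moment d / 2 turns L / 2 into L d / 4. *)
Lemma gsmooth_le s y : gsmooth f s y <= f y + L * d%:R / 4 * s ^+ 2.
Proof.
have qd : quad_lip (fun u => s * dot (grad f y) u) by apply/quad_lipZ/quad_lip_dot.
have qs : quad_lip (fun u => L / 2 * s ^+ 2 * sqnorm u).
  by apply/quad_lipZ/quad_lip_sqnorm.
have qc : quad_lip (fun u : 'rV[R]_d => f y) by exact: quad_lip_cst.
have -> : f y + L * d%:R / 4 * s ^+ 2 =
    gexp (fun u => (f y + s * dot (grad f y) u) + L / 2 * s ^+ 2 * sqnorm u).
  rewrite gexpD ?gexpD//; last exact: quad_lipD.
  rewrite gexp_cst gexpZ ?gexp_dot; last exact: quad_lip_dot.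
  by rewrite gexpZ ?gexp_sqnorm; [field|exact: quad_lip_sqnorm].
apply: ler_gexp; first exact: quad_lip_affine quad_lip_smooth.
  by do 2![apply: quad_lipD => //].
move=> u; have := @descent _ _ f L y (s *: u) L0 sf.
by rewrite dotZr sqnormZ mulrA.
Qed.

(** The point y + l s u is a convex combination of y + s u and y, so f_{ls} <= l f_s + (1 - l) f at
    [y]; conclude with f <= f_s. *)
Lemma gsmooth_homo l s y : 0 <= l <= 1 -> gsmooth f (l * s) y <= gsmooth f s y.
Proof.
move=> l01; have qf t := quad_lip_affine f y t quad_lip_smooth.
have : gsmooth f (l * s) y <= l * gsmooth f s y + (1 - l) * f y.
  rewrite -(gexpZ _ _ (qf s)) -[X in _ + X](@gexp_cst R d) -gexpD;
    [|exact: quad_lipZ|exact: quad_lip_cst].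
  apply: ler_gexp => //.
    by apply: quad_lipD; [exact: quad_lipZ|exact: quad_lip_cst].
  move=> u; have := cf (y + s *: u) y l l01.
  by rewrite scalerDr addrAC -scalerDl [l + _]addrC subrK scale1r scalerA.
move/le_trans; apply; have := le_gsmooth s y.
by have := l01; nra.
Qed.

(* Semiconcavity of [f], i.e. convexity of [L / 2 * sqnorm - f]. *)
Lemma smooth_semiconcave l y v : 0 <= l <= 1 ->
  l * f (y + v) + (1 - l) * f y - L / 2 * (l * (1 - l)) * sqnorm v <= f (y + l *: v).
Proof.
move=> /andP[l0 l1]; set w := y + l *: v.
(* Descent from [w] to y + v and to y, with weights l and 1 - l: the gradient terms cancel. *)
have := @descent _ _ f L w ((1 - l) *: v) L0 sf.
have := @descent _ _ f L w (- l *: v) L0 sf.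
have -> : w + (1 - l) *: v = y + v.
  by rewrite /w -addrA -scalerDl [l + _]addrC subrK scale1r.
have -> : w + - l *: v = y by rewrite /w scaleNr addrK.
rewrite !dotZr !sqnormZ; move: (dot _ _) (f w) => a b h1 h2.
have {}h2 := ler_wpM2l l0 h2.
have {}h1 : (1 - l) * f y <=
    (1 - l) * (b + - l * a + L / 2 * ((- l) ^+ 2 * sqnorm v)).
  by rewrite ler_wpM2l// subr_ge0.
lra.
Qed.

Lemma gsmooth_growth l s y : 0 <= l <= 1 ->
  gsmooth f s y <= gsmooth f (l * s) y + L * d%:R / 4 * (s ^+ 2 - (l * s) ^+ 2).
Proof.
move=> l01; have qf t := quad_lip_affine f y t quad_lip_smooth.
have qn : quad_lip (fun u => - (L / 2 * (l * (1 - l)) * s ^+ 2) * sqnorm u).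
  by apply/quad_lipZ/quad_lip_sqnorm.
have qc : quad_lip (fun u : 'rV[R]_d => (1 - l) * f y) by exact: quad_lip_cst.
have ql : quad_lip (fun u => l * f (y + s *: u)) by exact: quad_lipZ.
have : l * gsmooth f s y + (1 - l) * f y - L / 2 * (l * (1 - l)) * s ^+ 2 * (d%:R / 2)
    <= gsmooth f (l * s) y.
  rewrite -mulNr -gexp_sqnorm -(gexpZ _ _ quad_lip_sqnorm).
  rewrite -(gexpZ _ _ (qf s)) -[X in _ + X + _](@gexp_cst R d) -gexpD//
    -gexpD//; last exact: quad_lipD.
  apply: ler_gexp => //; first by do 2![apply: quad_lipD => //].
  move=> u; have := @smooth_semiconcave l y (s *: u) l01.
  by rewrite sqnormZ scalerA; lra.
(* Adding (1 - l) times the bound on f_s - f gives the coefficient l (1 - l) + (1 - l) = 1 - l^2. *)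
have := gsmooth_le s y; have [_] := andP l01; rewrite -subr_ge0 => l1.
move=> /(ler_wpM2l l1); lra.
Qed.

Lemma gsmooth_variation s r y : 0 < s -> 0 < r ->
  gsmooth f s y <=
    gsmooth f r y + L * d%:R / 4 * Num.max 0 (s ^+ 2 - r ^+ 2).
Proof.
move=> s0 r0; have Ld : 0 <= L * d%:R / 4 by rewrite divr_ge0// mulr_ge0// ltW.
have [sr|/ltW rs] := leP s r.
  rewrite (@le_trans _ _ (gsmooth f r y))//; last first.
    by rewrite lerDl mulr_ge0// le_max lexx.
  have -> : s = (s / r) * r by rewrite divfK// gt_eqF.
  by apply: gsmooth_homo; rewrite divr_ge0 ?(ltW s0) ?(ltW r0)//= ler_pdivrMr// mul1r.
have rE : r = (r / s) * s by rewrite divfK// gt_eqF.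
apply: (@le_trans _ _ (gsmooth f r y + L * d%:R / 4 * (s ^+ 2 - r ^+ 2))).
  rewrite [in leRHS]rE; apply: gsmooth_growth.
  by rewrite divr_ge0 ?(ltW s0) ?(ltW r0)//= ler_pdivrMr// mul1r.
by rewrite lerD2l ler_wpM2l// le_max lexx orbT.
Qed.

(** Descent at [x] towards [x'] and tangency at [x] towards [z]; L t <= 1 leaves a decrease of t
    |p|^2 / 2, which the expansion of |x' - z|^2 matches. *)
Lemma gsmooth_gd_step s t x z : 0 < t -> t <= L^-1 ->
  let x' := x - t *: grad (gsmooth f s) x in
  gsmooth f s x' <=
    gsmooth f s z + (sqnorm (x - z) - sqnorm (x' - z)) / (2 * t).
Proof.
move=> t0 tL; rewrite grad_gsmooth; set p := gsmooth_grad s x => /=.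
have := gsmooth_descent s x (- t *: p).
have := gsmooth_tangent s x (- 1 *: (x - z)).
have -> : x + - 1 *: (x - z) = z by rewrite scaleN1r opprB addrC subrK.
rewrite -/p !dotZr sqnormZ dotuu -scaleNr [_ + _ - z]addrAC.
rewrite (sqnormD (x - z)) dotZr sqnormZ.
have -> : dot (x - z) p = dot p (x - z) by apply: eq_bigr => i _; rewrite mulrC.
move: (gsmooth f s _) (gsmooth f s x) (gsmooth f s _) (dot _ _) => a b c e.
move: (sqnorm (x - z)) (sqnorm_ge0 p) => D; move: (sqnorm p) => q q0 h1 h2.
have tL1 : L * t <= 1 by rewrite mulrC -ler_pdivlMr// mul1r.
have : L * t * (t * q) <= 1 * (t * q) by rewrite ler_wpM2r// mulr_ge0// ltW.
have -> : (D - (D + 2 * (- t * e) + (- t) ^+ 2 * q)) / (2 * t) = e - t * q / 2.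
  by field; rewrite gt_eqF.
lra.
Qed.

End Smoothing.

(** * The convergence rate, by telescoping *)

Theorem theorem3p1 (R : realType) (d : nat) (f : 'rV[R]_d -> R) (L : R)
  (xs : 'rV[R]_d) (sigma : nat -> R) (t : R) (x : nat -> 'rV[R]_d) :
  0 < L -> convex_fun f -> L_smooth L f -> is_minimizer f xs ->
  (forall n, (1 <= n)%N -> 0 < sigma n) ->
  0 < t -> t <= L^-1 ->
  (forall k, x k.+1 = x k - t *: grad (gsmooth f (sigma k.+1)) (x k)) ->
  forall k, (1 <= k)%N ->
    f (x k) - f xs <=
      sqnorm (x 0%N - xs) / (2 * t * k%:R)
      + L * d%:R / (4 * k%:R) *
        (\sum_(1 <= i < k.+1) sigma i ^+ 2
         + \sum_(2 <= i < k.+1) i%:R * Num.max 0 (sigma i ^+ 2 - sigma i.-1 ^+ 2)).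
Proof.
move=> L0 cf sf _ sigma0 t0 tL xE.
pose a i := gsmooth f (sigma i) (x i); pose D i := sqnorm (x i - xs).
pose m i := Num.max 0 (sigma i ^+ 2 - sigma i.-1 ^+ 2).
have step i z : a i.+1 <= gsmooth f (sigma i.+1) z +
    (sqnorm (x i - z) - sqnorm (x i.+1 - z)) / (2 * t).
  by rewrite /a xE; apply: (gsmooth_gd_step f L).
have a_xs i : a i.+1 - f xs <=
    (D i - D i.+1) / (2 * t) + L * d%:R / 4 * sigma i.+1 ^+ 2.
  have := step i xs; have := gsmooth_le f L L0 cf sf (sigma i.+1) xs.
  by rewrite /D; lra.
(* The step decreases the smoothing of radius [sigma i.+1]; returning to radius [sigma i] costs the
   [m] term. Both radii must be positive, hence 1 <= i. *)
have a_prev i : (1 <= i)%N -> a i.+1 <= a i + L * d%:R / 4 * m i.+1.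
  move=> /sigma0 s0; have s1 := sigma0 i.+1 isT.
  have := gsmooth_variation f L L0 cf sf _ _ (x i) s1 s0.
  rewrite -/(a i) -/(m i.+1) => /(le_trans _); apply.
  rewrite (le_trans (step i (x i)))//.
  have -> : sqnorm (x i - x i) = 0.
    by rewrite subrr /sqnorm big1 // => j _; rewrite mxE expr0n.
  rewrite sub0r gerDl mulNr oppr_le0.
  by rewrite divr_ge0 ?sqnorm_ge0 ?mulr_ge0 ?(ltW t0).
(* Induction splits the weight k + 2 as (k + 1) + 1: [a_prev] carries the k + 1 copies back to
   [a k.+1], and [a_xs] bounds the last one. *)
have main k : k.+1%:R * (a k.+1 - f xs) <= (D 0%N - D k.+1) / (2 * t) +
    L * d%:R / 4 * (\sum_(1 <= i < k.+2) sigma i ^+ 2 +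
                    \sum_(2 <= i < k.+2) i%:R * m i).
  elim: k => [|k IHk].
    by rewrite big_nat1 big_geq// addr0 mul1r; exact: a_xs.
  rewrite [\sum_(1 <= i < _) _]big_nat_recr//= [\sum_(2 <= i < _) _]big_nat_recr//=.
  have := a_xs k.+1; have := ler_wpM2l (ler0n R k.+1) (a_prev k.+1 isT).
  (* [a_prev] yields [m k.+2] with weight k + 1; nonnegativity raises it to the weight k + 2 of the
     sum. *)
  have : 0 <= L * d%:R / 4 * m k.+2.
    by rewrite mulr_ge0 ?le_max ?lexx// divr_ge0// mulr_ge0// ltW.
  rewrite -[k.+2%:R]natr1; lra.
case=> // k _; have k0 : 0 < k.+1%:R :> R by rewrite ltr0n.
(* Smoothing only raises f, so the bound on [a k.+1] passes to f itself. *)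
have fa : f (x k.+1) <= a k.+1 by apply: (le_gsmooth f L).
have : k.+1%:R * (f (x k.+1) - f xs) <= D 0%N / (2 * t) +
    L * d%:R / 4 * (\sum_(1 <= i < k.+2) sigma i ^+ 2 +
                    \sum_(2 <= i < k.+2) i%:R * m i).
  have : k.+1%:R * (f (x k.+1) - f xs) <= k.+1%:R * (a k.+1 - f xs).
    by rewrite ler_pM2l// lerD2r.
  move=> /le_trans -/(_ _ (main k)) /le_trans; apply.
  rewrite lerD2r ler_wpM2r ?invr_ge0 ?mulr_ge0 ?(ltW t0)//.
  by rewrite lerBlDr lerDl sqnorm_ge0.
rewrite mulrC -ler_pdivlMr// => /le_trans; apply.
rewrite le_eqVlt; apply/orP; left; apply/eqP; rewrite /m /D.
by field; rewrite !gt_eqF.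
Qed.
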